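(* Let $\tau>0$, $\upsilon>0$, $T>0$, $L\in\mathbb{R}$, $a_1,a_2\in\mathbb{R}$ with $a_2\neq 0$, and consider the reaction-diffusion equation with constant time delay $$\partial_t u-\upsilon^2\partial_{xx}u+a_1u(x,t)+a_2u(x,t-\tau)=f(x,t),\quad (x,t)\in\mathbb{R}\times(0,T),$$ with $u=u_0$ on $\mathbb{R}\times[-\tau,0]$ and $u(\pm\infty,t)=0$ for $t\in(0,T)$. Consider the Neumann-Neumann waveform relaxation (NNWR) error iteration with relaxation parameter $\theta$ for this problem on the two subdomains $\Omega_1=(-\infty,L)$ and $\Omega_2=(L,\infty)$, started from an admissible initial interface error $g^0$. Then: (i) for $0<\theta<1/2$, $\theta\neq 1/4$, the NNWR iteration converges linearly; (ii) for $\theta=1/4$, the NNWR iteration converges in two iterations, for every time window length $T>0$.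
   Context: NNWR error iteration. Since the problem is linear, the iteration is written for the error, i.e. with $f=0$ and $u_0=0$. Given $g^0:[0,T]\to\mathbb{R}$ (initial error on the interface $\{x=L\}$), for $k=1,2,\dots$ and $i=1,2$ let $e_i^k$ solve the Dirichlet problem $$\partial_t e_i^k-\upsilon^2\partial_{xx}e_i^k+a_1e_i^k(x,t)+a_2e_i^k(x,t-\tau)=0 \text{ in }\Omega_i\times(0,T),$$ $$e_i^k=0\text{ on }\Omega_i\times[-\tau,0],\quad e_i^k(L,t)=g^{k-1}(t),\ t\in(0,T),$$ with $e_1^k(-\infty,t)=0$ and $e_2^k(\infty,t)=0$; then let $\phi_i^k$ solve the Neumann problem $$\partial_t \phi_i^k-\upsilon^2\partial_{xx}\phi_i^k+a_1\phi_i^k(x,t)+a_2\phi_i^k(x,t-\tau)=0 \text{ in }\Omega_i\times(0,T),$$ $$\phi_i^k=0\text{ on }\Omega_i\times[-\tau,0],\quad \phi_1^k(-\infty,t)=0,\quad \phi_2^k(\infty,t)=0,$$ $$\partial_x\phi_1^k(L,t)=\partial_xe_1^k(L,t)-\partial_xe_2^k(L,t),\qquad -\partial_x\phi_2^k(L,t)=\partial_xe_1^k(L,t)-\partial_xe_2^k(L,t),\quad t\in(0,T);$$ and update $g^k(t)=g^{k-1}(t)-\theta\left(\phi_1^k(L,t)+\phi_2^k(L,t)\right)$. Regularity conventions. Solutions $w\in\{e_i^k,\phi_i^k\}$ are classical: continuous on $\overline{\Omega_i}\times[-\tau,T]$, with $\partial_x w$ continuous on $\overline{\Omega_i}\times[0,T]$,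 and $\partial_t w,\partial_{xx}w$ continuous on $\Omega_i\times(0,T)$. Conditions at $\pm\infty$ mean convergence to $0$ as $x\to\pm\infty$, uniformly in $t\in(0,T)$. An initial interface error $g^0$ is admissible if it is continuous on $[0,T]$ and all iterates $e_i^k,\phi_i^k$ exist as such classical solutions. Convergence. Let $\|g\|=\sup_{t\in[0,T]}|g(t)|$. The iteration converges linearly if, for every admissible $g^0\not\equiv0$, there is $\rho\in(0,1)$ with $g^{k}\not\equiv 0$ for all $k$ and $\lim_{k\to\infty}\|g^{k}\|/\|g^{k-1}\|=\rho$ (so in particular $g^k\to0$). It converges in two iterations if, for every admissible $g^0$, the errors $e_1^k$, $e_2^k$ and $g^k$ vanish identically for all $k\ge2$. *)

(* Defs.v *)
From HB Require Import structures.
From mathcomp Require Import all_boot all_order all_algebra.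
From mathcomp Require Import all_classical all_reals all_analysis.

Set Implicit Arguments.
Unset Strict Implicit.
Unset Printing Implicit Defensive.

Import Order.TTheory GRing.Theory Num.Theory.
Import numFieldNormedType.Exports.

Local Open Scope classical_set_scope.
Local Open Scope ring_scope.

(* Derivative of f at x relative to D: one-sided at an endpoint of an interval
   D, the usual one at an interior point.                                     *)
Definition diff_quot (R : realType) (f : R -> R) (x y : R) : R :=
  (f y - f x) / (y - x).

Definition derivable_within (R : realType) (D : set R) (f : R -> R) (x : R) :=
  cvg (diff_quot f x y @[y --> within D x^']).

Definition derive_within (R : realType) (D : set R) (f : R -> R) (x : R) : R :=
  lim (diff_quot f x y @[y --> within D x^']).

(* Space-time functions are curried, w x t with x the space variable. *)
Definition dx (R : realType) (Omega : set R) (w : R -> R -> R) (x t : R) : R :=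
  derive_within (closure Omega) (w ^~ t) x.

Definition dt (R : realType) (w : R -> R -> R) (x t : R) : R := derive1 (w x) t.

Definition dxx (R : realType) (w : R -> R -> R) (x t : R) : R :=
  derive1n 2 (w ^~ t) x.

Record regular (R : realType) (tau T : R) (Omega : set R) (w : R -> R -> R) :
    Prop := Regular {
  regular_continuous :
    {within closure Omega `*` `[- tau, T], continuous (uncurry w)} ;
  regular_derivable_x : forall x t, closure Omega x -> t \in `[0, T] ->
    derivable_within (closure Omega) (w ^~ t) x ;
  regular_continuous_dx :
    {within closure Omega `*` `[0, T], continuous (uncurry (dx Omega w))} ;
  regular_derivable_t : forall x t, Omega x -> t \in `]0, T[ ->
    derivable (w x) t 1 ;
  regular_continuous_dt :
    {within Omega `*` `]0, T[, continuous (uncurry (dt w))} ;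
  regular_derivable_xx : forall x t, Omega x -> t \in `]0, T[ ->
    derivable (derive1 (w ^~ t)) x 1 ;
  regular_continuous_dxx :
    {within Omega `*` `]0, T[, continuous (uncurry (dxx w))} }.

(* The filter at_infinity is -oo or +oo, according to the end of Omega at which
   w vanishes. The condition on the interface is not included.                *)
Record classical_solution (R : realType) (tau nu T a1 a2 : R) (Omega : set R)
    (at_infinity : set_system R) (w : R -> R -> R) : Prop := ClassicalSolution {
  solution_regular : regular tau T Omega w ;
  solution_pde : forall x t, Omega x -> t \in `]0, T[ ->
    dt w x t - nu ^+ 2 * dxx w x t + a1 * w x t + a2 * w x (t - tau) = 0 ;
  solution_initial : forall x t, Omega x -> t \in `[- tau, 0] -> w x t = 0 ;
  solution_infinity : {uniform `]0, T[, w @ at_infinity --> (fun=> 0)} }.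

(* Iterates are indexed from 1: the functions e1 0, e2 0, phi1 0, phi2 0 are
   irrelevant, and g k matters only on [0, T].                                *)
Record nnwr_iteration (R : realType) (tau nu T L a1 a2 theta : R)
    (g : nat -> R -> R) (e1 e2 phi1 phi2 : nat -> R -> R -> R) : Prop :=
    NNWRIteration {
  nnwr_e1 : forall k, (1 <= k)%N ->
    classical_solution tau nu T a1 a2 `]-oo, L[ -oo%R (e1 k) ;
  nnwr_e2 : forall k, (1 <= k)%N ->
    classical_solution tau nu T a1 a2 `]L, +oo[ +oo%R (e2 k) ;
  nnwr_e1_dirichlet : forall k t, (1 <= k)%N -> t \in `]0, T[ ->
    e1 k L t = g k.-1 t ;
  nnwr_e2_dirichlet : forall k t, (1 <= k)%N -> t \in `]0, T[ ->
    e2 k L t = g k.-1 t ;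
  nnwr_phi1 : forall k, (1 <= k)%N ->
    classical_solution tau nu T a1 a2 `]-oo, L[ -oo%R (phi1 k) ;
  nnwr_phi2 : forall k, (1 <= k)%N ->
    classical_solution tau nu T a1 a2 `]L, +oo[ +oo%R (phi2 k) ;
  nnwr_phi1_neumann : forall k t, (1 <= k)%N -> t \in `]0, T[ ->
    dx `]-oo, L[ (phi1 k) L t =
    dx `]-oo, L[ (e1 k) L t - dx `]L, +oo[ (e2 k) L t ;
  nnwr_phi2_neumann : forall k t, (1 <= k)%N -> t \in `]0, T[ ->
    - dx `]L, +oo[ (phi2 k) L t =
    dx `]-oo, L[ (e1 k) L t - dx `]L, +oo[ (e2 k) L t ;
  nnwr_update : forall k t, (1 <= k)%N -> t \in `[0, T] ->
    g k t = g k.-1 t - theta * (phi1 k L t + phi2 k L t) }.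

Definition admissible (R : realType) (tau nu T L a1 a2 theta : R)
    (g0 : R -> R) : Prop :=
  {within `[0, T], continuous g0} /\
  exists g e1 e2 phi1 phi2,
    g 0%N = g0 /\ nnwr_iteration tau nu T L a1 a2 theta g e1 e2 phi1 phi2.

Definition supnorm (R : realType) (T : R) (g : R -> R) : R :=
  sup [set `|g t| | t in `[0, T]].

Definition vanishes (R : realType) (T : R) (g : R -> R) : Prop :=
  forall t, t \in `[0, T] -> g t = 0.

Definition vanishes_on (R : realType) (tau T : R) (Omega : set R)
    (w : R -> R -> R) : Prop :=
  forall x t, closure Omega x -> t \in `[- tau, T] -> w x t = 0.

(* The iterates are quantified after rho: the rate depends only on g0. *)
Definition converges_linearly (R : realType) (tau nu T L a1 a2 theta : R) :
    Prop :=
  forall g0 : R -> R, admissible tau nu T L a1 a2 theta g0 ->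
  ~ vanishes T g0 ->
  exists2 rho : R, 0 < rho < 1 &
    forall g e1 e2 phi1 phi2,
      g 0%N = g0 -> nnwr_iteration tau nu T L a1 a2 theta g e1 e2 phi1 phi2 ->
      (forall k, ~ vanishes T (g k)) /\
      supnorm T (g k) / supnorm T (g k.-1) @[k --> \oo] --> rho.

Definition converges_in_two_iterations (R : realType)
    (tau nu T L a1 a2 theta : R) : Prop :=
  forall g0 : R -> R, admissible tau nu T L a1 a2 theta g0 ->
  forall g e1 e2 phi1 phi2,
    g 0%N = g0 -> nnwr_iteration tau nu T L a1 a2 theta g e1 e2 phi1 phi2 ->
    forall k, (2 <= k)%N ->
      [/\ vanishes_on tau T `]-oo, L[ (e1 k),
          vanishes_on tau T `]L, +oo[ (e2 k) & vanishes T (g k)].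

(* Main.v *)
(* Fold both half lines onto y >= 0, y being the distance to the interface. The
   maximum principle gives uniqueness there for the Dirichlet as well as for the
   Neumann problem, the delay term being absorbed by a weight exp (- lam t) with
   lam large. Uniqueness makes e2 the mirror image of e1, so the jump of the
   normal derivatives is twice a one-sided derivative of e1; hence phi1 = 2 e1,
   phi2 = 2 e2, and g k = (1 - 4 theta) g (k - 1) on [0, T].                  *)
Require Import Defs.
From mathcomp Require Import all_boot all_order all_algebra.
From mathcomp Require Import ring lra.
From mathcomp Require Import all_classical all_reals all_analysis.
Import Order.TTheory GRing.Theory Num.Theory.
Import numFieldNormedType.Exports.
Set Implicit Arguments.
Unset Strict Implicit.
Unset Printing Implicit Defensive.

Local Open Scope classical_set_scope.
Local Open Scope ring_scope.

(** * Limits, derivatives and maxima in one variable *)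

(** Serves to restrict a jointly continuous [w] to time sections and space sections, and to
    transport it along the fold. *)
Lemma within_continuous_comp_prod (R : realType) (V : topologicalType)
    (A B : set R) (D : set V) (w : R -> R -> R) (u v : V -> R) :
  {within A `*` B, continuous (uncurry w)} -> continuous u -> continuous v ->
  (forall s, D s -> A (u s) /\ B (v s)) ->
  {within D, continuous (fun s => w (u s) (v s))}.
Proof.
move=> /subspace_continuousP cw cu cv uvD.
apply/subspace_continuousP => s Ds P Pw.
have cuv : (u s', v s') @[s' --> s] --> (u s, v s).
  exact: cvg_pair (cu s) (cv s).
have wP : \forall z \near (u s, v s), (A `*` B) z -> P (uncurry w z).
  exact: (cw (u s, v s) (uvD _ Ds) _ Pw).
have cwP : \forall s' \near s, (A `*` B) (u s', v s') -> P (w (u s') (v s')).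
  exact: (cuv _ wP).
suff : \forall s' \near s, D s' -> P (w (u s') (v s')) by [].
by apply: filterS cwP => s' {}wP Ds'; exact: wP (uvD _ Ds').
Qed.

Lemma cvg_eqfun (T U : Type) (F : set_system T) (G : set_system U) (f g : T -> U) :
  f x @[x --> F] --> G -> f =1 g -> g x @[x --> F] --> G.
Proof. by move=> fG /funext <-. Qed.

Lemma cvg_dnbhs_shift (R : realType) (f : R -> R) (x l : R) :
  f y @[y --> x^'] --> l <-> f (h + x) @[h --> 0^'] --> l.
Proof.
split=> /cvgrPdist_lt fl; apply/cvgrPdist_lt => e e0.
- have /= [d d0 H] := fl _ e0.
  exists d => //= h /= hd h0; apply: H => /=.
    by move: hd; rewrite sub0r opprD addrCA subrr addr0.
  by rewrite -subr_eq0 addrK.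
- have /= [d d0 H] := fl _ e0.
  exists d => //= y /= yd yx; have := H (y - x).
  by rewrite /= sub0r opprB subrK subr_eq0; apply.
Qed.

(** Bridge between the library derivative, a limit in the increment, and [diff_quot], a limit in the
    moving point; one-sided limits then follow by restricting the filter. *)
Lemma is_derive_diff_quotP (R : realType) (f : R -> R) (x df : R) :
  is_derive x 1 f df <-> diff_quot f x y @[y --> x^'] --> df.
Proof.
have quotE h : h^-1 *: ((f \o shift x) (h *: 1) - f x) = diff_quot f x (h + x).
  by rewrite /diff_quot /= /GRing.scale /= mulr1 addrK mulrC.
have E : (fun h => h^-1 *: ((f \o shift x) (h *: 1) - f x)) =
          (fun h => diff_quot f x (h + x)) by apply/funext.
split.
- move=> [dx' <-]; apply/cvg_dnbhs_shift; rewrite -E; exact: dx'.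
- move=> /cvg_dnbhs_shift; rewrite -E => H.
  apply: DeriveDef; first by apply/cvg_ex; exists df.
  exact/cvg_lim.
Qed.

(** Left difference quotients are nonnegative. Only earlier points are compared, because the maximum
    it is applied to may sit at the final time of a strip. *)
Lemma derive_ge0_left_max (R : realType) (f : R -> R) (a x df : R) :
  a < x -> is_derive x 1 f df -> (forall y, a < y < x -> f y <= f x) ->
  0 <= df.
Proof.
move=> ax /is_derive_diff_quotP /cvg_dnbhs_at_left fx fmax.
rewrite -(cvg_lim _ fx)//; apply: limr_ge; first by apply/cvg_ex; exists df.
near=> y; have yx : y < x by near: y; exact: nbhs_left_lt.
rewrite /diff_quot -mulrNN -invrN !opprB divr_ge0// ?subr_ge0; last exact: ltW.
apply: fmax; rewrite yx andbT.
by near: y; exact: nbhs_left_gt.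
Unshelve. all: by end_near. Qed.

(** The first derivative [p] vanishes at [c]. Were [q] positive, [p] would be positive just to the
    right of [c], and the mean value theorem would give a value above [f c]. *)
Lemma derive2_le0_max (R : realType) (f p : R -> R) (a b c q : R) :
  a < c < b -> (forall x, a < x < b -> is_derive x 1 f (p x)) ->
  is_derive c 1 p q -> (forall x, a < x < b -> f x <= f c) -> q <= 0.
Proof.
move=> /andP[ac cb] fp /is_derive_diff_quotP /cvg_dnbhs_at_right pq fmax.
have pc0 : p c = 0.
  have c_ab : c \in `]a, b[ by rewrite in_itv/= ac.
  have f0 : is_derive c 1 f 0.
    apply: (derive1_at_max (ltW (lt_trans ac cb)) _ c_ab) => t.
      by rewrite in_itv/= => /fp ?; exact: ex_derive.
    by rewrite in_itv/= => /fmax.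
  have fpc : is_derive c 1 f (p c) by apply: fp; rewrite ac.
  by rewrite -(@derive_val _ _ _ _ _ _ _ fpc) (@derive_val _ _ _ _ _ _ _ f0).
rewrite leNgt; apply/negP => q0.
have [d /= d0 dP] : \forall y \near c^'+, 0 < diff_quot p c y.
  exact: cvgr_gt pq _ q0.
(* Halving keeps [c + e] strictly inside both the radius where the quotients of [p] are positive and
   the interval up to [b]. *)
pose e := Num.min (d / 2) ((b - c) / 2).
have e0 : 0 < e by rewrite lt_min !divr_gt0// subr_gt0.
have ed : e < d by rewrite gt_min ltr_pdivrMr// ltr_pMr// ltr1n.
have eb : c + e < b.
  suff : e < b - c by rewrite ltrBrDl.
  by rewrite gt_min orbC ltr_pdivrMr// ltr_pMr// ?ltr1n// subr_gt0.
have ce : c < c + e by rewrite ltrDl.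
have fp' x : x \in `[c, c + e] -> is_derive x 1 f (p x).
  rewrite in_itv/= => /andP[cx xe]; apply: fp.
  by rewrite (lt_le_trans ac cx) (le_lt_trans xe eb).
have cf : {within `[c, c + e], continuous f}.
  by apply: derivable_within_continuous => x /fp' fx; exact: ex_derive.
have fp_oo x : x \in `]c, c + e[ -> is_derive x 1 f (p x).
  by move=> xce; apply: fp'; exact: subset_itv_oo_cc xce.
have [x + fE] := MVT ce fp_oo cf; rewrite in_itv/= => /andP[cx xe].
have : 0 < p x.
  have /= := dP x; rewrite /diff_quot pc0 subr0 pmulr_lgt0; last first.
    by rewrite invr_gt0 subr_gt0.
  apply=> //; rewrite ltr0_norm ?subr_lt0// opprB.
  by rewrite (lt_trans _ ed)// ltrBlDl.
rewrite -(pmulr_lgt0 _ e0); have -> : p x * e = f (c + e) - f c.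
  by rewrite fE addrAC subrr add0r.
by rewrite subr_gt0 ltNge fmax// eb (lt_trans ac ce).
Qed.

(** At an endpoint both functions are the one-sided limit of the same values. This carries
    identities known on an open interval, such as the interface conditions, to its ends. *)
Lemma eq_itvcc_of_itvoo (R : realType) (f g : R -> R) (a b : R) :
  a < b -> {within `[a, b], continuous f} -> {within `[a, b], continuous g} ->
  (forall x, a < x < b -> f x = g x) -> forall x, a <= x <= b -> f x = g x.
Proof.
move=> ab /(continuous_within_itvP _ ab)[_ fa fb].
move=> /(continuous_within_itvP _ ab)[_ ga gb] fg x /andP[].
rewrite !le_eqVlt => /predU1P[<- _|ax /predU1P[->|xb]]; last by rewrite fg// ax.
- apply: cvg_unique fa _ => //; apply: cvg_trans ga.
  apply: near_eq_cvg; near=> y; apply/esym/fg/andP; split.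
    by near: y; exact: nbhs_right_gt.
  by near: y; exact: nbhs_right_lt.
- apply: cvg_unique fb _ => //; apply: cvg_trans gb.
  apply: near_eq_cvg; near=> y; apply/esym/fg/andP; split.
    by near: y; exact: nbhs_left_gt.
  by near: y; exact: nbhs_left_lt.
Unshelve. all: by end_near. Qed.

Lemma is_derive_expRN (R : realType) (k x : R) :
  is_derive x 1 (fun y => expR (- (k * y))) (- (k * expR (- (k * x)))).
Proof.
have dlin : is_derive x 1 (fun y : R => - (k * y)) (- k).
  have := is_deriveN (is_deriveZ k (is_derive_id x (1 : R))).
  by rewrite /GRing.scale /= mulr1.
have := @is_derive1_comp _ expR (fun y => - (k * y)) x _ _ (is_derive_expR _) dlin.
by rewrite mulrN mulrC.
Qed.

(** * The half-line problem: attained maxima and linearity *)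

(** Beyond [A] all values are below [f y0 t0], so the maximum over the compact rectangle [[0, A] x
    [0, S]], which contains [(y0, t0)], is global. *)
Lemma halfstrip_max (R : realType) (f : R -> R -> R) (S A y0 t0 : R) :
  {within `[0, +oo[ `*` `[0, S], continuous (uncurry f)} ->
  0 <= y0 -> 0 <= t0 <= S ->
  (forall y t, A <= y -> 0 <= t <= S -> f y t < f y0 t0) ->
  exists y1 t1, [/\ 0 <= y1, 0 <= t1 <= S &
    forall y t, 0 <= y -> 0 <= t <= S -> f y t <= f y1 t1].
Proof.
move=> cf y00 t0S fA.
have y0A : y0 <= A by rewrite leNgt; apply/negP => /ltW/fA/(_ t0S); rewrite ltxx.
pose K : set (R * R) := `[0, A] `*` `[0, S].
have K0 : K !=set0 by exists (y0, t0); split; rewrite /= in_itv/= ?y00.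
have cK : compact K by apply: compact_setX; exact: segment_compact.
have cfK : {within K, continuous (uncurry f)}.
  apply: continuous_subspaceW cf => -[y t] [/= yA tS]; split => //=.
  by move: yA; rewrite !in_itv/= andbT => /andP[].
have [[y1 t1]] := compact_EVT_max K0 cK cfK.
rewrite inE => -[/= y1A t1S] fmax; exists y1, t1; split.
- by move: y1A; rewrite in_itv/= => /andP[].
- by move: t1S; rewrite in_itv.
have in_K y t : 0 <= y <= A -> 0 <= t <= S -> f y t <= f y1 t1.
  by move=> yA tS; apply: (fmax (y, t)); rewrite inE; split; rewrite /= in_itv.
move=> y t y_ge0 tS; have [yA|/ltW Ay] := leP y A; first by rewrite in_K ?y_ge0.
by rewrite (le_trans (ltW (fA _ _ Ay tS)))// in_K// y00.
Qed.

(* A solution on either half line, seen on [0, +oo[ through the distance to the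
   interface; d is its inward normal derivative at the interface.           *)
Record halfline_solution (R : realType) (tau nu T a1 a2 : R)
    (w : R -> R -> R) (d : R -> R) : Prop := HalflineSolution {
  halfline_continuous :
    {within `[0, +oo[ `*` `[- tau, T], continuous (uncurry w)} ;
  halfline_boundary : forall t : R, 0 < t < T ->
    diff_quot (w ^~ t) 0 y @[y --> 0^'+] --> d t ;
  halfline_pde : forall t : R, 0 < t < T -> exists p q r : R -> R,
    forall y : R, 0 < y -> [/\ is_derive y 1 (w ^~ t) (p y), is_derive y 1 p (q y),
      is_derive t 1 (w y) (r y) &
      r y - nu ^+ 2 * q y + a1 * w y t + a2 * w y (t - tau) = 0] ;
  halfline_initial : forall y t : R, 0 <= y -> - tau <= t <= 0 -> w y t = 0 ;
  halfline_infinity : forall e : R, 0 < e -> exists A : R, forall y t : R,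
    A <= y -> 0 < t < T -> `|w y t| < e }.

Section linear_combination.
Context {R : realType} {tau nu T a1 a2 : R}.
Local Notation solution := (halfline_solution tau nu T a1 a2).

Lemma halfline_solution_lin (c : R) (w1 w2 : R -> R -> R) (d1 d2 : R -> R) :
  solution w1 d1 -> solution w2 d2 ->
  solution (fun y t => w1 y t + c * w2 y t) (fun t => d1 t + c * d2 t).
Proof.
move=> s1 s2; split.
- have /subspace_continuousP c1 := halfline_continuous s1.
  have /subspace_continuousP c2 := halfline_continuous s2.
  apply/subspace_continuousP => -[y t] yt.
  apply: (cvg_eqfun (cvgD (c1 _ yt) (cvgM (cvg_cst c) (c2 _ yt)))).
  by case.
- move=> t tT.
  apply: (cvg_eqfun (cvgD (halfline_boundary s1 tT)
    (cvgM (cvg_cst c) (halfline_boundary s2 tT)))) => y /=.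
  by rewrite /diff_quot; ring.
- move=> t tT.
  have [p1 [q1 [r1 pde1]]] := halfline_pde s1 tT.
  have [p2 [q2 [r2 pde2]]] := halfline_pde s2 tT.
  exists (fun y => p1 y + c * p2 y), (fun y => q1 y + c * q2 y),
    (fun y => r1 y + c * r2 y) => y y0.
  have [w1p p1q w1r eq1] := pde1 _ y0; have [w2p p2q w2r eq2] := pde2 _ y0.
  split.
  + exact: (is_deriveD w1p (is_deriveZ c w2p)).
  + exact: (is_deriveD p1q (is_deriveZ c p2q)).
  + exact: (is_deriveD w1r (is_deriveZ c w2r)).
  + rewrite -[RHS]addr0 -{1}eq1 -[X in _ = _ + X](mulr0 c) -eq2; ring.
- by move=> y t y0 tt; rewrite (halfline_initial s1)// (halfline_initial s2)// mulr0 addr0.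
- move=> e e0.
  have e2 : 0 < e / 2 by rewrite divr_gt0.
  (* The denominator [1 + |c|] instead of [|c|] also covers [c = 0]. *)
  have c2 : 0 < e / 2 / (1 + `|c|) by rewrite divr_gt0// ltr_pwDl.
  have [A1 H1] := halfline_infinity s1 e2.
  have [A2 H2] := halfline_infinity s2 c2.
  exists (Num.max A1 A2) => y t; rewrite ge_max => /andP[yA1 yA2] tT.
  have := H2 _ _ yA2 tT; rewrite ltr_pdivlMr ?ltr_pwDl// => w2e.
  have := H1 _ _ yA1 tT => w1e.
  apply: le_lt_trans (ler_normD _ _) _; rewrite normrM.
  have := normr_ge0 (w2 y t); nra.
Qed.

End linear_combination.

(** * Maximum principle and uniqueness on the half line *)

Lemma continuous_weight (R : realType) (lam : R) :
  continuous (fun z : R * R => expR (- (lam * z.2))).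
Proof.
move=> z; apply: continuous_comp; last exact: continuous_expR.
by apply: cvgN; apply: cvgM; [exact: cvg_cst|exact: cvg_snd].
Qed.

Section maximum_principle.
Context {R : realType} {tau nu T a1 a2 : R} (tau_gt0 : 0 < tau).
Local Notation solution := (halfline_solution tau nu T a1 a2).

(** Multiplying [w] by the weight adds [lam] to the reaction coefficient; [a1 + lam >= 1 + |a2|]
    then dominates the delay coefficient with a margin of 1. *)
Let lam : R := 1 + `|a1| + `|a2|.
Let weight t : R := expR (- (lam * t)).

Let weight_le1 t : 0 <= t -> weight t <= 1.
Proof.
move=> t0; rewrite /weight -[leRHS]expR0 ler_expR oppr_le0 mulr_ge0//.
by rewrite /lam !addr_ge0.
Qed.

Let continuous_weighted w d S : solution w d -> S < T ->
  {within `[0, +oo[ `*` `[0, S], continuous (uncurry (fun y t => weight t * w y t))}.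
Proof.
move=> sw ST; apply/subspace_continuousP => -[y t] [/= y0 tS].
have : {within `[0, +oo[ `*` `[0, S], continuous (uncurry w)}.
  apply: continuous_subspaceW (halfline_continuous sw) => -[y' t'] [/= -> ].
  rewrite !in_itv/= => /andP[t'0 t'S]; split => //; apply/andP; split.
    by rewrite (le_trans _ t'0)// oppr_le0 ltW.
  by rewrite (le_trans t'S)// ltW.
move=> /subspace_continuousP/(_ (y, t) (conj y0 tS)) cw.
have cE : weight z.2 @[z --> within (`[0, +oo[ `*` `[0, S]) (nbhs (y, t))] --> weight t.
  by apply: cvg_within_filter; exact: (@continuous_weight _ lam (y, t)).
by apply: (cvg_eqfun (cvgM cE cw)); case.
Qed.

(* Subtracting [eps * expR (- y)] makes the maximum interior: at the interface
   the perturbation is negative, and its inward slope is positive.          *)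
Lemma weighted_lt_bound w d S M : solution w d ->
  (forall t, 0 < t < T -> w 0 t = 0 \/ d t = 0) -> 0 < S < T -> 0 < M ->
  (forall y t, 0 <= y -> 0 <= t <= S -> `|weight t * w y t| <= M) ->
  forall y t, 0 <= y -> 0 <= t <= S -> weight t * w y t < M.
Proof.
move=> sw bc /andP[S0 ST] M0 wM y0 t0 y00 t0S; rewrite ltNge; apply/negP => Mw.
(* At the maximum the equation will give [(1 + |a2|) * (M - eps) <= nu ^+ 2 * eps + |a2| * M], that
   is [M <= (k - 1) * eps]. With [eps = M / k] the right side is [M - eps], which is absurd. *)
pose k : R := 2 + nu ^+ 2 + `|a2|.
have k0 : 0 < k by rewrite /k !ltr_wpDr// sqr_ge0.
pose eps := M / k.
have eps0 : 0 < eps by rewrite divr_gt0.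
have epsk : eps * k = M by rewrite divfK// gt_eqF.
have nu2 := sqr_ge0 nu.
have a2_ge0 := normr_ge0 a2.
have epsM : eps < M by rewrite -epsk /k; nra.
pose z y t := weight t * w y t - eps * expR (- y).
have cz : {within `[0, +oo[ `*` `[0, S], continuous (uncurry z)}.
  have /subspace_continuousP cv := continuous_weighted sw ST.
  apply/subspace_continuousP => -[y t] yt.
  have cE : eps * expR (- x.1) @[x --> within (`[0, +oo[ `*` `[0, S]) (nbhs (y, t))]
      --> eps * expR (- y).
    apply: cvgM; first exact: cvg_cst.
    apply: continuous_cvg; first exact: continuous_expR.
    by apply: cvg_within_filter; apply: cvgN; exact: cvg_fst.
  by apply: (cvg_eqfun (cvgB (cv _ yt) cE)); case.
have z0 : M - eps <= z y0 t0.
  rewrite /z lerB// ger_pMr// -[leRHS]expR0 ler_expR oppr_le0//.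
have [A HA] : exists A, forall y t, A <= y -> 0 < t < T -> `|w y t| < M - eps.
  by apply: (halfline_infinity sw); rewrite subr_gt0.
have w_t0 y : 0 <= y -> w y 0 = 0.
  by move=> y_ge0; rewrite (halfline_initial sw)// lexx andbT oppr_le0 ltW.
(* Decay is available for [0 < t < T] only; at [t = 0] the initial condition makes [z] negative. *)
have zA y t : Num.max 0 A <= y -> 0 <= t <= S -> z y t < z y0 t0.
  rewrite ge_max => /andP[y_ge0 yA] /andP[].
  rewrite le_eqVlt => /predU1P[<- _|t_gt0 tS]; apply: lt_le_trans z0.
    rewrite /z w_t0// mulr0 sub0r (@lt_trans _ _ 0)// ?subr_gt0//.
    by rewrite oppr_lt0 mulr_gt0// expR_gt0.
  have : `|w y t| < M - eps by apply: HA => //; rewrite t_gt0 (le_lt_trans tS).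
  apply: le_lt_trans; rewrite (@le_trans _ _ (weight t * w y t))//.
    by rewrite /z gerBl mulr_ge0// ?ltW// expR_gt0.
  rewrite (le_trans (ler_norm _))// normrM ger0_norm ?expR_ge0//.
  by rewrite ler_piMl// weight_le1// ltW.
have [y1 [t1 [y10 /andP[t10 t1S] zmax]]] := halfstrip_max cz y00 t0S zA.
have z1 : M - eps <= z y1 t1 by rewrite (le_trans z0)// zmax.
have z1_gt0 : 0 < z y1 t1 by rewrite (lt_le_trans _ z1)// subr_gt0.
have v1 : M - eps <= weight t1 * w y1 t1.
  by rewrite (le_trans z1)// /z gerBl mulr_ge0// ?ltW// expR_gt0.
have {}t10 : 0 < t1.
  rewrite lt_neqAle t10 andbT; apply/eqP => t1E.
  move: z1_gt0; rewrite /z -t1E w_t0// mulr0 sub0r oppr_gt0; apply/negP.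
  by rewrite -leNgt mulr_ge0// ?(ltW eps0)// expR_ge0.
have t1T : 0 < t1 < T by rewrite t10 (le_lt_trans t1S).
have W0 : 0 < weight t1 := expR_gt0 _.
have {}y10 : 0 < y1.
  rewrite lt_neqAle y10 andbT; apply/eqP => y1E; move: zmax z1_gt0; rewrite -y1E.
  move=> zmax z1_gt0; have [w0|dt0] := bc _ t1T.
    move: z1_gt0; rewrite /z w0 mulr0 sub0r oppr0 expR0 mulr1 oppr_gt0.
    by move=> /lt_trans/(_ eps0); rewrite ltxx.
  have dz : diff_quot (z ^~ t1) 0 y @[y --> 0^'+] --> eps.
    have dE : is_derive (0 : R) 1 (fun y : R => expR (- y)) (- 1).
      have := is_derive_expRN 1 (0 : R); rewrite mulr0 oppr0 expR0 mulr1.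
      by under eq_fun do rewrite mul1r.
    have /is_derive_diff_quotP/cvg_dnbhs_at_right dq := dE.
    suff : diff_quot (z ^~ t1) 0 y @[y --> 0^'+] --> weight t1 * d t1 - eps * -1.
      by rewrite dt0 mulr0 sub0r mulrN1 opprK.
    apply: (cvg_eqfun (cvgB
      (cvgM (cvg_cst (weight t1)) (halfline_boundary sw t1T))
      (cvgM (cvg_cst eps) dq))) => y.
    transitivity (weight t1 * diff_quot (w ^~ t1) 0 y
      - eps * diff_quot (fun x => expR (- x)) 0 y); first by [].
    by rewrite /diff_quot /z; ring.
  suff : eps <= 0 by rewrite leNgt eps0.
  rewrite -(cvg_lim _ dz)//; apply: limr_le; first by apply/cvg_ex; exists eps.
  near=> y; have y_gt0 : 0 < y by near: y; exact: nbhs_right_gt.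
  rewrite /diff_quot subr0 pmulr_lle0 ?invr_gt0// subr_le0.
  by apply: zmax; [exact: ltW|rewrite ltW].
have [p [q [r pde]]] := halfline_pde sw t1T.
have [_ p1q w1r pde1] := pde _ y10.
(* The perturbation [eps * expR (- y)] does not depend on time, so [weight t * w y1 t] is itself
   maximal at [t1] among earlier times. *)
have dt_ge0 : 0 <= weight t1 * (r y1 - lam * w y1 t1).
  apply: (@derive_ge0_left_max _ (fun t => weight t * w y1 t) 0 t1) => //.
    have dW : is_derive t1 1 weight (- (lam * weight t1)).
      exact: is_derive_expRN.
    have -> : weight t1 * (r y1 - lam * w y1 t1) =
        weight t1 *: r y1 + w y1 t1 *: (- (lam * weight t1)).
      by rewrite /GRing.scale /=; ring.
    exact: (is_deriveM dW w1r).
  move=> t /andP[t_gt0 tt1].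
  have := zmax y1 t (ltW y10); rewrite /z lerD2r; apply.
  by rewrite ltW//= (le_trans (ltW tt1)).
have dxx_le0 : weight t1 * q y1 - eps * expR (- y1) <= 0.
  have dexp (y c : R) : is_derive y 1 (fun y => c * expR (- y)) (- (c * expR (- y))).
    have := is_deriveZ c (is_derive_expRN 1 y); rewrite /GRing.scale /= !mul1r mulrN.
    by under eq_fun do rewrite mul1r.
  have dp := is_deriveD (is_deriveZ (weight t1) p1q) (dexp y1 eps).
  (* The end [2 * y1] merely puts [y1] inside an open interval of positive points. *)
  apply: (@derive2_le0_max _ (z ^~ t1) _ 0 (2 * y1) y1 _ _ _ dp).
  - by rewrite y10/=; nra.
  - move=> y /andP[y_gt0 _]; have [wp _ _ _] := pde _ y_gt0.
    have := is_deriveB (is_deriveZ (weight t1) wp) (dexp y eps).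
    by rewrite opprK.
  - by move=> y /andP[y_gt0 _]; apply: zmax; rewrite ltW//= t1S.
(* Either the delayed time falls in the initial history, or it lies in the strip, where [M] bounds
   the weighted solution; the weight at [t1] is smaller than at [t1 - tau]. *)
have delay : `|weight t1 * w y1 (t1 - tau)| <= M.
  have [t1tau|tau_t1] := leP t1 tau.
    rewrite (halfline_initial sw) ?(ltW y10)// ?mulr0 ?normr0 ?(ltW M0)//.
    by rewrite subr_le0 t1tau lerBrDr addNr ltW.
  apply: le_trans (wM y1 (t1 - tau) (ltW y10) _); last first.
    by rewrite subr_ge0 ltW//= (le_trans _ t1S)// gerBl ltW.
  rewrite !normrM ler_wpM2r// !ger0_norm ?expR_ge0// ler_expR lerN2 ler_wpM2l//.
    by rewrite /lam !addr_ge0.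
  by rewrite gerBl ltW.
have expy1 : expR (- y1) <= 1.
  by rewrite -[leRHS]expR0 ler_expR oppr_le0 ltW.
set v := weight t1 * w y1 t1 in v1 *.
have v_gt0 : 0 < v by rewrite (lt_le_trans _ v1)// subr_gt0.
have delay' : - (`|a2| * M) <= a2 * (weight t1 * w y1 (t1 - tau)).
  rewrite lerNl -mulrN (le_trans (ler_norm _))// normrM normrN ler_wpM2l//.
have a1v : - (`|a1| * v) <= a1 * v.
  by rewrite lerNl -mulNr ler_wpM2r ?(ltW v_gt0)// -normrN ler_norm.
have nuq : nu ^+ 2 * (weight t1 * q y1) <= nu ^+ 2 * eps.
  rewrite ler_wpM2l// (@le_trans _ _ (eps * expR (- y1)))//.
    by rewrite -subr_le0.
  by rewrite ger_pMr.
have pdeW : weight t1 * r y1 - nu ^+ 2 * (weight t1 * q y1) + a1 * v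
    + a2 * (weight t1 * w y1 (t1 - tau)) = 0.
  by rewrite -[RHS](mulr0 (weight t1)) -pde1 /v; ring.
have rv : lam * v <= weight t1 * r y1.
  by move: dt_ge0; rewrite mulrBr subr_ge0 /v mulrCA.
(* In [lam * v] the summand [|a1| * v] absorbs the reaction term, leaving [(1 + |a2|) * v] against
   diffusion and delay. *)
have : (1 + `|a2|) * v <= nu ^+ 2 * eps + `|a2| * M.
  by move: rv; rewrite /lam !mulrDl; lra.
have : (1 + `|a2|) * (M - eps) <= (1 + `|a2|) * v by rewrite ler_wpM2l// addr_ge0.
by move: epsk; rewrite /k; nra.
Unshelve. all: by end_near. Qed.

(** If [w] were nonzero at time [S], its weighted modulus would attain a positive maximum on the
    strip up to [S], and the strict bound applied to [w] and [- w] would put that maximum below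
    itself. The disjunction covers Dirichlet and Neumann data at once. *)
Lemma halfline_unique_lt w d : solution w d ->
  (forall t, 0 < t < T -> w 0 t = 0 \/ d t = 0) ->
  forall y t, 0 <= y -> 0 < t < T -> w y t = 0.
Proof.
move=> sw bc y S y_ge0 ST; have [S0 _] := andP ST.
apply: contrapT => /eqP w_neq0.
pose f y t := `|weight t * w y t|.
have cf : {within `[0, +oo[ `*` `[0, S], continuous (uncurry f)}.
  have [_ lt_ST] := andP ST.
  have /subspace_continuousP cv := continuous_weighted sw lt_ST.
  apply/subspace_continuousP => -[y' t'] /cv /cvg_norm fcv.
  by apply: (cvg_eqfun fcv); case.
have fS : 0 < f y S by rewrite normr_gt0 mulf_neq0// gt_eqF// expR_gt0.
have [A HA] := halfline_infinity sw fS.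
have f0 y' : 0 <= y' -> f y' 0 = 0.
  move=> y'0; rewrite /f (halfline_initial sw) ?mulr0 ?normr0//.
  by rewrite lexx andbT oppr_le0 ltW.
have fA y' t : Num.max 0 A <= y' -> 0 <= t <= S -> f y' t < f y S.
  rewrite ge_max => /andP[y'0 y'A] /andP[].
  rewrite le_eqVlt => /predU1P[<- _|t_gt0 tS]; first by rewrite f0.
  apply: le_lt_trans (HA _ t y'A _); last first.
    by rewrite t_gt0 (le_lt_trans tS)//; case/andP: ST.
  rewrite /f normrM ger0_norm ?expR_ge0// ler_piMl// weight_le1// ltW//.
have SS : 0 <= S <= S by rewrite lexx andbT ltW.
have [y1 [t1 [y10 t1S fmax]]] := halfstrip_max cf y_ge0 SS fA.
have M0 : 0 < f y1 t1 by rewrite (lt_le_trans fS)// fmax.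
(* The zero solution is obtained as [w - w]; it lets [- w] be written as a linear combination. *)
have zero : solution (fun _ _ => 0) (fun=> 0).
  have := halfline_solution_lin (-1) sw sw.
  by under eq_fun do under eq_fun do rewrite mulN1r subrr;
     under [fun t => _ + _]eq_fun do rewrite mulN1r subrr.
have sNw := halfline_solution_lin (-1) zero sw.
have w_lt := weighted_lt_bound sw bc ST M0 fmax y10 t1S.
have : weight t1 * (0 + -1 * w y1 t1) < f y1 t1.
  apply: (weighted_lt_bound sNw _ ST M0) => // [t /bc[] ->|y' t y'0 tS].
  - by left; rewrite mulr0 addr0.
  - by right; rewrite mulr0 addr0.
  - by rewrite add0r mulN1r mulrN normrN fmax.
rewrite add0r mulN1r mulrN => Nw_lt.
have : f y1 t1 < f y1 t1 by rewrite {1}/f ltr_norml ltrNl Nw_lt.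
by rewrite ltxx.
Qed.

(** Times [t <= 0] are covered by the initial condition, and [t = T] by continuity in time. *)
Lemma halfline_unique w d : 0 < T -> solution w d ->
  (forall t, 0 < t < T -> w 0 t = 0 \/ d t = 0) ->
  forall y t, 0 <= y -> - tau <= t <= T -> w y t = 0.
Proof.
move=> T0 sw bc y t y_ge0 /andP[tau_t tT].
have [t0|t0] := leP t 0; first by rewrite (halfline_initial sw)// tau_t.
have cw : {within `[0, T], continuous (w y)}.
  apply: (within_continuous_comp_prod (u := fun=> y) (v := id) (halfline_continuous sw)).
  - exact: cst_continuous.
  - by move=> s.
  - move=> s; rewrite /= !in_itv/= y_ge0 => /andP[s0 ->]; rewrite andbT (le_trans _ s0)//.
    by rewrite oppr_le0 ltW.
apply: (eq_itvcc_of_itvoo T0 cw (fun x => @cst_continuous _ _ 0 x)).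
- by move=> s sT; exact: (halfline_unique_lt sw).
- by rewrite (ltW t0).
Qed.

End maximum_principle.

(** * Folding a half line onto the distance to the interface *)

Lemma is_derive_affine_comp (R : realType) (f : R -> R) (L s y df : R) :
  is_derive (L + s * y) 1 f df ->
  is_derive y 1 (fun y => f (L + s * y)) (s * df).
Proof.
move=> fdf; have du : is_derive y 1 (fun y : R => L + s * y) s.
  have := is_deriveD (is_derive_cst L y (1 : R)) (is_deriveZ s (is_derive_id y (1 : R))).
  by rewrite /GRing.scale /= mulr1 add0r.
by have := @is_derive1_comp _ f (fun y => L + s * y) y _ _ fdf du; rewrite mulrC.
Qed.

Lemma derivable_of_within (R : realType) (D : set R) (f : R -> R) (x : R) :
  nbhs x D -> derivable_within D f x -> derivable f x 1.
Proof.
move=> xD /cvg_ex[/= l fl]; have fxl : diff_quot f x y @[y --> x^'] --> l.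
  move=> P /fl PP.
  have DP : \forall y \near x^', D y -> P (diff_quot f x y) by exact: PP.
  have Dx' : \forall y \near x^', D y := nbhs_dnbhs xD.
  by apply: filterS2 DP Dx' => y; exact.
have /is_derive_diff_quotP fxl' := fxl.
exact: ex_derive.
Qed.

Section fold.
Context {R : realType} {tau nu T a1 a2 L s : R} {Omega : set R}
  {at_infinity : set_system R}
  (T0 : 0 < T) (tau0 : 0 < tau) (s2 : s ^+ 2 = 1)
  (Omega_open : open Omega)
  (OmegaE : Omega = [set x | 0 < s * (x - L)])
  (closureE : closure Omega = [set x | 0 <= s * (x - L)])
  (inftyE : L + s * y @[y --> +oo%R] --> at_infinity).

(** Treats both half lines at once, with [s = -1] on the left and [s = 1] on the right. The chain
    rule puts a factor [s] on first derivatives and [s ^+ 2 = 1] on second ones, so the equation is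
    unchanged. *)
Lemma halfline_of_classical (w : R -> R -> R) :
  classical_solution tau nu T a1 a2 Omega at_infinity w ->
  halfline_solution tau nu T a1 a2 (fun y t => w (L + s * y) t)
    (fun t => s * dx Omega w L t).
Proof.
move=> [reg pde init inf].
have s_neq0 : s != 0 by apply: contra_eq_neq s2 => ->; rewrite expr0n/= eq_sym oner_neq0.
have sK y : s * (L + s * y - L) = y.
  by rewrite addrAC subrr add0r mulrA -expr2 s2 mul1r.
have OmegaP y : 0 < y -> Omega (L + s * y) by rewrite OmegaE /= sK.
have closureP y : 0 <= y -> closure Omega (L + s * y) by rewrite closureE /= sK.
have cw : {within `[0, +oo[ `*` `[- tau, T], continuous (fun z => w (L + s * z.1) z.2)}.
  apply: (within_continuous_comp_prod (regular_continuous reg)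
     (u := fun z : R * R => L + s * z.1) (v := snd)).
  - move=> z; apply: cvgD; first exact: cvg_cst.
    by apply: cvgM; [exact: cvg_cst|exact: cvg_fst].
  - move=> z; exact: cvg_snd.
  - move=> [y t] [/= y0 tT]; split => //; apply: closureP.
    by move: y0; rewrite in_itv/= andbT.
split.
- by rewrite (_ : uncurry _ = (fun z => w (L + s * z.1) z.2))//; apply/funext; case.
- move=> t /andP[t0 tT].
  have LL : closure Omega L by rewrite closureE /= subrr mulr0.
  have tT' : t \in `[0, T] by rewrite in_itv/= !ltW.
  have dwL := regular_derivable_x reg LL tT'.
  (* For [y > 0] the point [L + s * y] lies in the closure and differs from [L], so the right limit
     at 0 runs along the filter that defines [dx] at the interface. *)
  have toL : L + s * y @[y --> 0^'+] --> within (closure Omega) L^'.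
    have affL : L + s * y @[y --> (0 : R)] --> L + s * 0.
      by apply: cvgD; [exact: cvg_cst|apply: cvgM; [exact: cvg_cst|exact: cvg_id]].
    rewrite mulr0 addr0 in affL.
    move=> P; rewrite /within /= => PL.
    have : \forall y \near (0 : R), L + s * y != L -> closure Omega (L + s * y) -> P (L + s * y).
      exact: (affL _ PL).
    apply: filterS => y + y0; apply; last exact/closureP/ltW.
    by rewrite -subr_eq0 addrAC subrr add0r mulf_neq0// gt_eqF.
  have := cvg_comp _ _ toL dwL => dq.
  apply: (cvg_eqfun (cvgM (cvg_cst s) dq)) => y.
  transitivity (s * diff_quot (w ^~ t) L (L + s * y)); first by [].
  rewrite /diff_quot mulr0 addr0 subr0 addrAC subrr add0r.
  by rewrite invfM mulrCA [s * (_ * _)]mulrA mulfV// mul1r.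
- move=> t tT; exists (fun y => s * derive1 (w ^~ t) (L + s * y)),
    (fun y => dxx w (L + s * y) t), (fun y => dt w (L + s * y) t) => y y0.
  have tT' : t \in `]0, T[ by rewrite in_itv.
  have Oy := OmegaP _ y0.
  split.
  + have d1 : derivable (w ^~ t) (L + s * y) 1.
      apply: (@derivable_of_within _ (closure Omega)).
        by apply: filterS (open_nbhs_nbhs (conj Omega_open Oy)); exact: subset_closure.
      apply: (regular_derivable_x reg); first exact: subset_closure.
      by case/andP: tT => ? ?; rewrite in_itv/= !ltW.
    have := is_derive_affine_comp (f := w ^~ t) (derivableP d1).
    by rewrite -derive1E.
  + have := is_deriveZ s (is_derive_affine_comp
      (derivableP (regular_derivable_xx reg Oy tT'))).
    by rewrite -derive1E /GRing.scale /= mulrA -expr2 s2 mul1r.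
  + by rewrite /dt derive1E; apply: derivableP; exact: (regular_derivable_t reg).
  + exact: pde.
- move=> y t; rewrite le_eqVlt => /predU1P[<-|y0] tT; last first.
    by apply: init; [exact: OmegaP|rewrite in_itv].
  (* The initial condition holds on the open [Omega]; at [y = 0] it follows by continuity in
     space. *)
  have cw1 : {within `[0, 1], continuous (fun y => w (L + s * y) t)}.
    apply: (within_continuous_comp_prod (regular_continuous reg)
      (u := fun y : R => L + s * y) (v := fun=> t)).
    + move=> z; apply: cvgD; first exact: cvg_cst.
      by apply: cvgM; [exact: cvg_cst|exact: cvg_id].
    + exact: cst_continuous.
    + move=> z; rewrite /= !in_itv/= => /andP[z0 _]; split; first exact: closureP.
      by case/andP: tT => -> /= t0; rewrite (le_trans t0)// ltW.
  apply: (eq_itvcc_of_itvoo ltr01 cw1 (fun x => @cst_continuous _ _ 0 x)).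
    by move=> x /andP[x0 _]; apply: init; [exact: OmegaP|rewrite in_itv].
  by rewrite lexx ler01.
- move=> e e0.
  pose P (h : R -> R) := forall t, `]0, T[%classic t -> `|h t| < e.
  have wP : \forall x \near at_infinity, P (w x).
    apply: inf; apply/uniform_nbhs; exists [set z | ball z.1 e z.2]; split.
      by rewrite -entourage_ballE; exists e.
    by move=> h hP t /hP; rewrite /ball /= sub0r normrN.
  (* The filter [+oo] gives a strict bound [A < y], whereas [halfline_infinity] asks for [<=],
     whence [A + 1]. *)
  have /= [A [_ HA]] := inftyE wP; exists (A + 1) => y t yA tT.
  by apply: HA; rewrite /= ?in_itv// (lt_le_trans _ yA)// ltrDl.
Qed.

End fold.

(** * Errors of the iteration on the interface and on the two half lines *)

Lemma closure_itvNyo (R : realType) (z : R) :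
  closure `]-oo, z[%classic = [set x | x <= z].
Proof.
by rewrite -closure_lt; congr closure; apply/seteqP; split=> x /=; rewrite in_itv.
Qed.

Lemma closure_itvoy (R : realType) (z : R) :
  closure `]z, +oo[%classic = [set x | z <= x].
Proof.
rewrite -closure_gt; congr closure.
by apply/seteqP; split=> x /=; rewrite in_itv/= andbT.
Qed.

Section nnwr.
Context {R : realType} {tau nu T L a1 a2 theta : R}.
Context (tau0 : 0 < tau) (T0 : 0 < T).
Local Notation classical := (classical_solution tau nu T a1 a2).
Local Notation solution := (halfline_solution tau nu T a1 a2).

Lemma left_halfline w : classical `]-oo, L[ -oo%R w ->
  solution (fun y t => w (L + -1 * y) t) (fun t => -1 * dx `]-oo, L[ w L t).
Proof.
apply: halfline_of_classical => //.
- by rewrite sqrrN expr1n.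
- by apply/seteqP; split=> x /=; rewrite in_itv/= mulN1r opprB subr_gt0.
- rewrite closure_itvNyo.
  by apply/seteqP; split=> x /=; rewrite mulN1r opprB subr_ge0.
- move=> P [M [_ PM]]; exists (L - M); split; first exact: num_real.
  move=> y; rewrite ltrBlDl => LMy; apply: PM.
  by rewrite mulN1r ltrBlDr.
Qed.

Lemma right_halfline w : classical `]L, +oo[ +oo%R w ->
  solution (fun y t => w (L + 1 * y) t) (fun t => 1 * dx `]L, +oo[ w L t).
Proof.
apply: halfline_of_classical => //.
- by rewrite expr1n.
- by apply/seteqP; split=> x /=; rewrite in_itv/= andbT mul1r subr_gt0.
- rewrite closure_itvoy.
  by apply/seteqP; split=> x /=; rewrite mul1r subr_ge0.
- move=> P [M [_ PM]]; exists (M - L); split; first exact: num_real.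
  by move=> y; rewrite ltrBlDl => LMy; apply: PM; rewrite mul1r.
Qed.

Lemma continuous_trace (Omega : set R) at_infinity w : closure Omega L ->
  classical Omega at_infinity w -> {within `[0, T], continuous (w L)}.
Proof.
move=> OL sw.
apply: (within_continuous_comp_prod (u := fun=> L) (v := id)
  (regular_continuous (solution_regular sw))) => [|t|t].
- exact: cst_continuous.
- exact: cvg_id.
- rewrite /= !in_itv/= => /andP[t0 ->]; rewrite andbT; split => //.
  by rewrite (le_trans _ t0)// oppr_le0 ltW.
Qed.

Lemma halfline_boundary_eq0 w d t : solution w d -> 0 < t < T ->
  (forall y, 0 <= y -> w y t = 0) -> d t = 0.
Proof.
move=> sw tT w0; apply: cvg_unique (halfline_boundary sw tT) _ => //.
have : (0 : R) @[y --> (0 : R)^'+] --> (0 : R) by exact: cvg_cst.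
apply: cvg_trans; apply: near_eq_cvg; near=> y.
rewrite /diff_quot !w0 ?subrr ?mul0r// ltW//; near: y; exact: nbhs_right_gt.
Unshelve. all: by end_near. Qed.

Context {g : nat -> R -> R} {e1 e2 phi1 phi2 : nat -> R -> R -> R}.
Context (iter : nnwr_iteration tau nu T L a1 a2 theta g e1 e2 phi1 phi2).

(** After folding, [e1] and [e2] share their Dirichlet data, hence agree, and the jump of their
    derivatives is [2 * dx e1]. So [phi1 - 2 e1] and [phi2 - 2 e2] have zero Neumann data and
    vanish; each trace contributes [2 * g k.-1]. *)
Lemma neumann_traces k t : (1 <= k)%N -> 0 < t < T ->
  phi1 k L t + phi2 k L t = 4 * g k.-1 t.
Proof.
move=> k1 tT.
have E1 := left_halfline (nnwr_e1 iter k1).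
have E2 := right_halfline (nnwr_e2 iter k1).
have P1 := left_halfline (nnwr_phi1 iter k1).
have P2 := right_halfline (nnwr_phi2 iter k1).
have E12 := halfline_solution_lin (-1) E1 E2.
have uE12 y s : 0 <= y -> 0 < s < T -> e1 k (L + -1 * y) s + -1 * e2 k (L + 1 * y) s = 0.
  apply: (halfline_unique_lt tau0 E12) => {}s sT; left.
  rewrite !mulr0 addr0 (nnwr_e1_dirichlet iter) ?(nnwr_e2_dirichlet iter) ?in_itv//.
  by rewrite mulN1r subrr.
(* The inward slopes are [- dx e1] on the left and [dx e2] on the right, whence the sign. *)
have dE s : 0 < s < T ->
    dx `]-oo, L[ (e1 k) L s = - dx `]L, +oo[ (e2 k) L s.
  move=> sT; have := halfline_boundary_eq0 E12 sT (fun y y0 => uE12 y s y0 sT); lra.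
have uP1 := halfline_unique_lt tau0 (halfline_solution_lin (-2) P1 E1).
have uP2 := halfline_unique_lt tau0 (halfline_solution_lin (-2) P2 E2).
have {}uP1 : phi1 k L t = 2 * g k.-1 t.
  suff : phi1 k (L + -1 * 0) t + -2 * e1 k (L + -1 * 0) t = 0.
    by rewrite !mulr0 addr0 (nnwr_e1_dirichlet iter) ?in_itv//; lra.
  apply: uP1 => // s sT; right.
  by rewrite (nnwr_phi1_neumann iter) ?in_itv// dE//; ring.
have {}uP2 : phi2 k L t = 2 * g k.-1 t.
  suff : phi2 k (L + 1 * 0) t + -2 * e2 k (L + 1 * 0) t = 0.
    by rewrite !mulr0 addr0 (nnwr_e2_dirichlet iter) ?in_itv//; lra.
  apply: uP2 => // s sT; right.
  have sT' : s \in `]0, T[ by rewrite in_itv.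
  have := nnwr_phi2_neumann iter k1 sT'; rewrite dE//; lra.
by rewrite uP1 uP2; ring.
Qed.

(** Each update multiplies by [1 - 4 * theta]. The trace identity is known for [0 < t < T], the
    update is needed on [[0, T]], and continuity of both sides closes the gap. *)
Lemma interface_error k t : {within `[0, T], continuous (g 0%N)} ->
  0 <= t <= T -> g k t = (1 - 4 * theta) ^+ k * g 0%N t.
Proof.
move=> cg; elim: k t => [|k IH] t tT; first by rewrite expr0 mul1r.
have /subspace_continuousP cg' := cg.
have closL : closure `]-oo, L[%classic L by rewrite closure_itvNyo /=.
have closR : closure `]L, +oo[%classic L by rewrite closure_itvoy /=.
have /subspace_continuousP c1 := continuous_trace closL (nnwr_phi1 iter (ltn0Sn k)).
have /subspace_continuousP c2 := continuous_trace closR (nnwr_phi2 iter (ltn0Sn k)).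
have cphi : {within `[0, T], continuous (fun t => phi1 k.+1 L t + phi2 k.+1 L t)}.
  by apply/subspace_continuousP => s sT; exact: (cvgD (c1 _ sT) (c2 _ sT)).
(* The induction hypothesis lets [4 * g k] be expressed through [g 0], whose continuity is
   assumed. *)
have c4g : {within `[0, T], continuous (fun t => 4 * (1 - 4 * theta) ^+ k * g 0%N t)}.
  by apply/subspace_continuousP => s sT; exact: (cvgM (cvg_cst _) (cg' _ sT)).
have := eq_itvcc_of_itvoo T0 cphi c4g => phiE.
rewrite (nnwr_update iter) ?in_itv//= phiE//; last first.
  move=> s /andP[s0 sT]; rewrite neumann_traces ?s0// IH ?mulrA//.
  by rewrite !ltW.
by rewrite IH// exprS; ring.
Qed.

(** The Dirichlet datum of [e1 k] and [e2 k] is [g k.-1], so uniqueness on each half line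
    applies. *)
Lemma vanishing_errors k : (1 <= k)%N -> vanishes T (g k.-1) ->
  vanishes_on tau T `]-oo, L[ (e1 k) /\ vanishes_on tau T `]L, +oo[ (e2 k).
Proof.
move=> k1 gk0; split=> x t.
- rewrite closure_itvNyo /= in_itv/= => xL tT.
  have E1 := left_halfline (nnwr_e1 iter k1).
  have -> : x = L + -1 * (L - x) by ring.
  apply: (halfline_unique tau0 T0 E1) => [s sT||//]; last by rewrite subr_ge0.
  left; rewrite mulr0 addr0 (nnwr_e1_dirichlet iter) ?in_itv//.
  by apply: gk0; rewrite in_itv/=; case/andP: sT => ? ?; rewrite !ltW.
- rewrite closure_itvoy /= in_itv/= => xL tT.
  have E2 := right_halfline (nnwr_e2 iter k1).
  have -> : x = L + 1 * (x - L) by ring.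
  apply: (halfline_unique tau0 T0 E2) => [s sT||//]; last by rewrite subr_ge0.
  left; rewrite mulr0 addr0 (nnwr_e2_dirichlet iter) ?in_itv//.
  by apply: gk0; rewrite in_itv/=; case/andP: sT => ? ?; rewrite !ltW.
Qed.

End nnwr.

(** * Supremum norms and the two convergence statements *)

Lemma supnorm_max (R : realType) (T t0 : R) (h : R -> R) : 0 <= t0 <= T ->
  (forall t, 0 <= t <= T -> `|h t| <= `|h t0|) -> supnorm T h = `|h t0|.
Proof.
move=> t0T hmax; apply/eqP; rewrite eq_le; apply/andP; split.
- apply: ge_sup; first by exists `|h t0|, t0 => //=; rewrite in_itv.
  by move=> _ [t /= tT <-]; apply: hmax; rewrite in_itv in tT.
- apply: ub_le_sup; last by exists t0 => //=; rewrite in_itv.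
  by exists `|h t0| => _ [t /= tT <-]; apply: hmax; rewrite in_itv in tT.
Qed.

Unset Implicit Arguments.

Theorem theorem2 (R : realType) (tau nu T L a1 a2 theta : R)
    (tau_gt0 : 0 < tau) (nu_gt0 : 0 < nu) (T_gt0 : 0 < T) (a2_neq0 : a2 != 0) :
  (0 < theta < 1 / 2 -> theta != 1 / 4 ->
     converges_linearly tau nu T L a1 a2 theta) /\
  (theta = 1 / 4 -> converges_in_two_iterations tau nu T L a1 a2 theta).
Proof.
split=> [/andP[theta_gt0 theta_lt] theta_neq g0 [cg0 _] g0_neq0|thetaE g0 [cg0 _]].
- have c_neq0 : 1 - 4 * theta != 0 by apply: contra_neq theta_neq; lra.
  have cabs : {within `[0, T], continuous (fun t => `|g0 t|)}.
    have /subspace_continuousP cg := cg0.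
    by apply/subspace_continuousP => s sT; exact: (cvg_norm (cg _ sT)).
  (* Every [g k] is a scalar multiple of [g0] on [[0, T]], so this maximizer of [|g0|] serves all
     iterates. *)
  have [t0] := EVT_max (ltW T_gt0) cabs; rewrite in_itv/= => t0T g0max.
  have g0t0 : g0 t0 != 0.
    apply/eqP => g00; apply: g0_neq0 => t /g0max.
    by rewrite g00 normr0 normr_le0 => /eqP.
  (* [0 < theta < 1 / 2] places [1 - 4 * theta] strictly between -1 and 1, and [theta != 1 / 4]
     keeps it from 0. *)
  exists `|1 - 4 * theta|.
    by rewrite normr_gt0 c_neq0/= ltr_norml; apply/andP; split; lra.
  move=> g e1 e2 phi1 phi2 gE iter.
  have gk k t : 0 <= t <= T -> g k t = (1 - 4 * theta) ^+ k * g0 t.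
    by rewrite -gE; apply: (interface_error tau_gt0 T_gt0 iter); rewrite gE.
  have normg k : supnorm T (g k) = `|1 - 4 * theta| ^+ k * `|g0 t0|.
    rewrite (supnorm_max t0T) ?gk ?normrM ?normrX// => t tT.
    by rewrite gk// normrM normrX ler_wpM2l// g0max// in_itv.
  split=> [k gk0|].
    have : g k t0 = 0 by apply: gk0; rewrite in_itv.
    by apply/eqP; rewrite gk// mulf_neq0// expf_neq0.
  (* The quotient is constant from [k = 1] on; at [k = 0] the predecessor is 0 again, so that index
     is discarded. *)
  apply: cvg_near_cst; near=> k; have k0 : (0 < k)%N by near: k; exact: nbhs_infty_gt.
  rewrite !normg -{1}(prednK k0) exprS -mulrA mulfK// mulf_neq0//.
    by rewrite expf_neq0// normr_eq0.
  by rewrite normr_eq0.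
- move=> g e1 e2 phi1 phi2 gE iter.
  (* The factor [1 - 4 * theta] is 0, so [g k] vanishes from [k = 1]; since [e1 k] and [e2 k] take
     their datum from [g k.-1], they vanish from [k = 2]. *)
  have gk0 k : (1 <= k)%N -> vanishes T (g k).
    move=> k1 t; rewrite in_itv/= => tT.
    rewrite (interface_error tau_gt0 T_gt0 iter) ?gE// thetaE.
    rewrite (_ : 1 - 4 * (1 / 4) = 0 :> R); last by field.
    by rewrite expr0n gtn_eqF// mul0r.
  move=> k k2; have k1 : (1 <= k)%N by exact: ltnW.
  have [] := vanishing_errors tau_gt0 T_gt0 iter k1; first by apply: gk0; case: k k2 {k1} => [|[]].
  by split=> //; exact: gk0.
Unshelve. all: by end_near. Qed.
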